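(* For all integers $n\geq0$ and $\alpha\geq1$, \[ p_{-2}\left(5^{2\alpha-1}n+\frac{7\cdot5^{2\alpha-1}+1}{12}\right)\equiv0\pmod{5^{\alpha}} \] and \[ p_{-2}\left(5^{2\alpha}n+\frac{11\cdot5^{2\alpha}+1}{12}\right)\equiv0\pmod{5^{\alpha+1}}. \]
   Context: $p_{-2}(n)$ is the number of $2$-colored partitions of $n$, i.e. $\sum_{n\geq0}p_{-2}(n)q^n=\prod_{i\geq1}(1-q^i)^{-2}$. *)

(* Defs.v *)
From mathcomp Require Import all_boot.

Set Implicit Arguments.
Unset Strict Implicit.
Unset Printing Implicit Defensive.

(* A 2-colored partition of n is encoded by its multiplicities: [m (c, i)] is
   the number of parts equal to [i.+1] of color [c].  No part and no
   multiplicity exceeds n, so the ranges ['I_n] and ['I_n.+1] lose nothing. *)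
Definition colored2_partitions (n : nat) : {set {ffun 'I_2 * 'I_n -> 'I_n.+1}} :=
  [set m : {ffun 'I_2 * 'I_n -> 'I_n.+1} |
     \sum_(x : 'I_2 * 'I_n) m x * x.2.+1 == n].

Definition p_minus2 (n : nat) : nat := #|colored2_partitions n|.

(* The offsets (7 * 5 ^ (2 alpha - 1) + 1) / 12 and (11 * 5 ^ (2 alpha) + 1) / 12
   are integers, so computing them with [%/] involves no rounding. *)
Lemma dvdn_offset_odd (alpha : nat) :
  1 <= alpha -> 12 %| 7 * 5 ^ (2 * alpha - 1) + 1.
Proof.
case: alpha => // a _; rewrite mulnS subn1 /= add1n expnS expnM mulnA.
by rewrite /dvdn -modnDml -modnMmr -modnXm exp1n.
Qed.

Lemma dvdn_offset_even (alpha : nat) : 12 %| 11 * 5 ^ (2 * alpha) + 1.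
Proof. by rewrite expnM /dvdn -modnDml -modnMmr -modnXm exp1n. Qed.

(* Main.v *)
Require Import Defs.
From mathcomp Require Import all_boot.
From HB Require Import structures.
From mathcomp Require Import all_order all_algebra all_field.
From mathcomp Require Import boolp.
From mathcomp Require Import ring zify.

(** Write E(q) for the Euler product and G for its inverse, so that G^2 is the
    generating function of p_{-2}.  Euler's pentagonal number theorem and
    Jacobi's formula for E^3 give the 5-dissection
      E(q) = A - q B - q^2 C   with   B = E(q^25),  A C = B^2,
    where A and C are series in q^5.  Taking the norm of both sides over the
    series in q^5 shows that x = q E(q^25) / E(q) satisfies
      x^5 = t(q^5) Y,  Y = 1 + 5 x + 15 x^2 + 25 x^3 + 25 x^4,
      t = q E(q^5)^6 / E(q)^6 = x Y.
    Let U keep the exponents divisible by 5.  The relation gives a five-term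
    recurrence that expresses each U(x^i) as a polynomial in t with explicit
    5-adic bounds on its coefficients.  The generating functions of the two
    families of values of p_{-2} are E(q^5)^-2 f(t) and E(q)^-2 f(t), obtained
    from each other by U; each pass through both gains a factor 5. *)

Set Implicit Arguments.
Unset Strict Implicit.
Unset Printing Implicit Defensive.

Import GRing.Theory Num.Theory.
Local Open Scope ring_scope.

(** * Formal power series and their 5-sections *)

Record fps (R : Type) := Fps { coefs :> nat -> R }.

HB.instance Definition _ (R : Type) := gen_eqMixin (fps R).
HB.instance Definition _ (R : Type) := gen_choiceMixin (fps R).

Lemma fpsP (R : Type) (f g : fps R) : f =1 g -> f = g.
Proof. by case: f g => f [g] /= fg; congr Fps; apply: funext. Qed.

Section FpsRing.
Variable R : comNzRingType.
Implicit Types f g h : fps R.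

Definition fps0 : fps R := Fps (fun=> 0).
Definition fpsD f g := Fps (fun n => f n + g n).
Definition fpsN f := Fps (fun n => - f n).
Definition fps1 : fps R := Fps (fun n => (n == 0%N)%:R).
Definition fpsM f g := Fps (fun n => \sum_(i < n.+1) f i * g (n - i)%N).

Lemma fpsDA : associative fpsD.
Proof. by move=> f g h; apply: fpsP => n /=; rewrite addrA. Qed.

Lemma fpsDC : commutative fpsD.
Proof. by move=> f g; apply: fpsP => n /=; rewrite addrC. Qed.

Lemma fps0D : left_id fps0 fpsD.
Proof. by move=> f; apply: fpsP => n /=; rewrite add0r. Qed.

Lemma fpsND : left_inverse fps0 fpsN fpsD.
Proof. by move=> f; apply: fpsP => n /=; rewrite addNr. Qed.

HB.instance Definition _ := GRing.isZmodule.Build (fps R) fpsDA fpsDC fps0D fpsND.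

Definition trunc n f : {poly R} := \poly_(i < n) f i.

(** A coefficient of a product depends on finitely many coefficients of the factors, so the ring
    laws below are inherited from [{poly R}] through truncations. *)
Lemma fpsM_trunc N n f g (p r : {poly R}) : (n < N)%N ->
  (forall i, (i < N)%N -> p`_i = f i) -> (forall i, (i < N)%N -> r`_i = g i) ->
  fpsM f g n = (p * r)`_n.
Proof.
move=> nN pf rg; rewrite coefM; apply: eq_bigr => i _.
by rewrite pf ?rg //; move: (ltn_ord i); lia.
Qed.

Lemma coef_trunc N i f : (i < N)%N -> (trunc N f)`_i = f i.
Proof. by rewrite coef_poly => ->. Qed.

Lemma fpsMC : commutative fpsM.
Proof.
move=> f g; apply: fpsP => n.
pose T := trunc n.+1; rewrite (@fpsM_trunc n.+1 _ _ _ (T f) (T g)) ?(@fpsM_trunc n.+1 _ _ _ (T g) (T f)) ?[T g * _]mulrC //;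
  by move=> i; apply: coef_trunc.
Qed.

Lemma fpsMA : associative fpsM.
Proof.
move=> f g h; apply: fpsP => n; pose T := trunc n.+1.
rewrite (@fpsM_trunc n.+1 _ _ _ (T f) (T g * T h)) ?(@fpsM_trunc n.+1 _ _ _ (T f * T g) (T h)) ?mulrA //.
all: move=> i iN; first [exact: coef_trunc | symmetry; apply: (@fpsM_trunc n.+1) => // j; exact: coef_trunc].
Qed.

Lemma fps1M : left_id fps1 fpsM.
Proof.
move=> f; apply: fpsP => n /=; rewrite big_ord_recl big1 ?addr0 ?mul1r ?subn0 //.
by move=> i _; rewrite mul0r.
Qed.

Lemma fpsMDl : left_distributive fpsM fpsD.
Proof.
by move=> f g h; apply: fpsP => n /=; rewrite -big_split; apply: eq_bigr => i _; rewrite mulrDl.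
Qed.

Lemma fps1_neq0 : fps1 != fps0.
Proof. by apply/eqP => /(congr1 (fun f => coefs f 0)) /= /eqP; rewrite oner_eq0. Qed.

HB.instance Definition _ :=
  GRing.Zmodule_isComNzRing.Build (fps R) fpsMA fpsMC fps1M fpsMDl fps1_neq0.

Lemma coefs0 n : (0 : fps R) n = 0. Proof. by []. Qed.
Lemma coefs1 n : (1 : fps R) n = (n == 0%N)%:R. Proof. by []. Qed.
Lemma coefsD f g n : (f + g) n = f n + g n. Proof. by []. Qed.
Lemma coefsN f n : (- f) n = - f n. Proof. by []. Qed.
Lemma coefsB f g n : (f - g) n = f n - g n. Proof. by []. Qed.
Lemma coefsM f g n : (f * g) n = \sum_(i < n.+1) f i * g (n - i)%N. Proof. by []. Qed.

Lemma coefs_sum I (r : seq I) (P : pred I) (F : I -> fps R) n :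
  (\sum_(i <- r | P i) F i) n = \sum_(i <- r | P i) F i n.
Proof. by elim/big_rec2: _ => // i _ f _ <-. Qed.

Lemma coefsMn f n k : (f *+ k) n = f n *+ k.
Proof. by elim: k => // k IH; rewrite !mulrSr coefsD IH. Qed.

Definition qv : fps R := Fps (fun n => (n == 1%N)%:R).

Lemma coefs_qvM f n : (qv * f) n = if n is n'.+1 then f n' else 0.
Proof.
rewrite coefsM; case: n => [|n].
  by rewrite big_ord1 mul0r.
rewrite big_ord_recl mul0r add0r big_ord_recl big1 ?addr0 ?mul1r //=; last first.
  by move=> i _; rewrite mul0r.
by rewrite subSS subn0.
Qed.

Lemma coefs_qvXM f k n : (qv ^+ k * f) n = if (n < k)%N then 0 else f (n - k)%N.
Proof.
elim: k n => [|k IH] n; first by rewrite mul1r subn0.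
by rewrite exprS -mulrA coefs_qvM; case: n => // n; rewrite IH ltnS subSS.
Qed.

Lemma coefs_qvX k n : (qv ^+ k) n = (n == k)%:R.
Proof.
rewrite -[qv ^+ k]mulr1 coefs_qvXM coefs1 subn_eq0.
by case: ltngtP.
Qed.

(** This is congruence modulo q^N. Identities between infinite products are proved for every N and
    then collected by [eqm_eq]. *)
Definition eqm N f g := forall i, (i < N)%N -> f i = g i.

Lemma eqm_sym N f g : eqm N f g -> eqm N g f.
Proof. by move=> fg i iN; rewrite fg. Qed.
Lemma eqm_trans N g f h : eqm N f g -> eqm N g h -> eqm N f h.
Proof. by move=> fg gh i iN; rewrite fg ?gh. Qed.
Lemma eqm_le M N f g : (M <= N)%N -> eqm N f g -> eqm M f g.
Proof. by move=> MN fg i iM; apply: fg; apply: leq_trans MN. Qed.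
Lemma eqmM N f f' g g' : eqm N f f' -> eqm N g g' -> eqm N (f * g) (f' * g').
Proof.
move=> ff gg i iN; rewrite !coefsM; apply: eq_bigr => j _.
by rewrite ff ?gg //; move: (ltn_ord j); lia.
Qed.
Lemma eqmD N f f' g g' : eqm N f f' -> eqm N g g' -> eqm N (f + g) (f' + g').
Proof. by move=> ff gg i iN; rewrite !coefsD ff ?gg. Qed.
Lemma eqmN N f f' : eqm N f f' -> eqm N (- f) (- f').
Proof. by move=> ff i iN; rewrite !coefsN ff. Qed.
Lemma eqmX N f f' k : eqm N f f' -> eqm N (f ^+ k) (f' ^+ k).
Proof. by move=> ff; elim: k => // k IH; rewrite !exprS; apply: eqmM. Qed.
Lemma eqm_sum N I (r : seq I) (P : pred I) (F F' : I -> fps R) :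
  (forall i, P i -> eqm N (F i) (F' i)) ->
  eqm N (\sum_(i <- r | P i) F i) (\sum_(i <- r | P i) F' i).
Proof. by move=> FF; elim/big_rec2: _ => // i f g Pi fg; apply: eqmD => //; apply: FF. Qed.
Lemma eqm_prod N I (r : seq I) (P : pred I) (F F' : I -> fps R) :
  (forall i, P i -> eqm N (F i) (F' i)) ->
  eqm N (\prod_(i <- r | P i) F i) (\prod_(i <- r | P i) F' i).
Proof. by move=> FF; elim/big_rec2: _ => // i f g Pi fg; apply: eqmM => //; apply: FF. Qed.

Lemma eqm_qvXM N M k f g : (N <= k + M)%N -> eqm M f g -> eqm N (qv ^+ k * f) (qv ^+ k * g).
Proof. by move=> NM fg i iN; rewrite !coefs_qvXM; case: ltnP => // ki; apply: fg; lia. Qed.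

Lemma eqm_qvX0 N k f : (N <= k)%N -> eqm N (qv ^+ k * f) 0.
Proof. by move=> Nk i iN; rewrite coefs_qvXM (leq_trans iN Nk). Qed.

Lemma eqm_eq f g : (forall N, eqm N f g) -> f = g.
Proof. by move=> fg; apply: fpsP => n; apply: (fg n.+1). Qed.

(* [fexp f] is f(q^5), and [fsub r f] collects the coefficients of f at the
   exponents 5 n + r. *)
Definition fexp f := Fps (fun n => if (5 %| n)%N then f (n %/ 5)%N else 0).
Definition fsub r f := Fps (fun n => f (5 * n + r)%N).

Lemma big5 (T : Type) (idx : T) (op : Monoid.law idx) (F : nat -> T) m :
  \big[op/idx]_(i < 5 * m) F i = \big[op/idx]_(k < m) \big[op/idx]_(r < 5) F (5 * k + r)%N.
Proof.
elim: m => [|m IH]; first by rewrite !big_ord0.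
rewrite [RHS]big_ord_recr -IH -!(big_mkord xpredT) /= mulnSr.
rewrite (@big_cat_nat _ _ _ (5 * m)) ?leq_addr //=; congr (op _ _).
rewrite -{1}[(5 * m)%N]add0n big_addn addnC addnK big_mkord.
by apply: eq_bigr => i _; rewrite addnC.
Qed.

Lemma sum5 (F : nat -> R) m :
  \sum_(i < 5 * m) F i = \sum_(k < m) \sum_(r < 5) F (5 * k + r)%N.
Proof. exact: big5. Qed.

Lemma coefs_fexpE f n : fexp f n = if (5 %| n)%N then f (n %/ 5)%N else 0. Proof. by []. Qed.

Lemma coefs_fexp f n r : (r < 5)%N -> fexp f (5 * n + r) = if r == 0%N then f n else 0.
Proof.
move=> r5 /=; have -> : (5 %| 5 * n + r)%N = (r == 0%N) by lia.
by case: eqP => // ->; congr (f _); lia.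
Qed.

(** Sections are linear over the series in q^5: only the multiples of 5 contribute to the
    convolution. *)
Lemma fsub_fexpM r f g : (r < 5)%N -> fsub r (fexp f * g) = f * fsub r g.
Proof.
move=> r5; apply: fpsP => n.
pose F i := fexp f i * g (5 * n + r - i)%N.
have -> : fsub r (fexp f * g) n = \sum_(i < 5 * n.+1) F i.
  have -> : fsub r (fexp f * g) n = \sum_(0 <= i < (5 * n + r).+1) F i by rewrite big_mkord.
  rewrite -(big_mkord xpredT F).
  (* The indices added to complete the last block lie strictly between 5 n + r and 5 n + 5, so none
     is a multiple of 5. *)
  rewrite [RHS](@big_cat_nat _ _ _ (5 * n + r).+1) //=; last by lia.
  rewrite [X in _ = _ + X]big_nat_cond [X in _ = _ + X]big1 ?addr0 // => i; rewrite andbT => /andP[i1 i2].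
  by rewrite /F /=; case: ifP => [/dvdnP[k ik]|_]; [lia|rewrite mul0r].
rewrite sum5 coefsM; apply: eq_bigr => k _.
rewrite big_ord_recl big1 => [|i _].
  rewrite addr0 /F coefs_fexp //=; congr (_ * g _); move: (ltn_ord k); lia.
by rewrite /F coefs_fexp // mul0r.
Qed.

Lemma fexpM : {morph fexp : f g / f * g}.
Proof.
move=> f g; apply: fpsP => n.
have [m [r [r5 ->]]] : exists m r, (r < 5)%N /\ n = (5 * m + r)%N.
  by exists (n %/ 5)%N, (n %% 5)%N; lia.
rewrite coefs_fexp // -[RHS]/(fsub r (fexp f * fexp g) m) fsub_fexpM // [RHS]coefsM.
have E i : fsub r (fexp g) i = if r == 0%N then g i else 0 by rewrite -coefs_fexp.
case: eqP E => _ E; first by apply: eq_bigr => i _; rewrite E.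
by rewrite big1 // => i _; rewrite E mulr0.
Qed.

Lemma fexp_zmod : zmod_morphism fexp.
Proof. by move=> f g; apply: fpsP => n /=; case: ifP; rewrite ?subrr. Qed.

Lemma fexp1 : fexp 1 = 1.
Proof.
apply: fpsP => n; rewrite coefs1 /=.
by case: ifPn => [/dvdnP[k ->]|]; [rewrite mulnK // muln_eq0 orbF | case: n].
Qed.

HB.instance Definition _ := GRing.isZmodMorphism.Build _ _ fexp fexp_zmod.
HB.instance Definition _ :=
  GRing.isMonoidMorphism.Build _ _ fexp (fexp1, fexpM).

Lemma fsub_zmod r : zmod_morphism (fsub r).
Proof. by move=> f g; apply: fpsP. Qed.

HB.instance Definition _ r := GRing.isZmodMorphism.Build _ _ (fsub r) (fsub_zmod r).

Lemma fexp_qv : fexp qv = qv ^+ 5.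
Proof.
apply: fpsP => n; rewrite coefs_qvX /=.
case: ifPn => [/dvdnP[k ->]|]; first by rewrite mulnK //; congr (_%:R); case: k => [|[|k]].
by case: eqP => // ->.
Qed.

Lemma fsub_qvX_fexp r s f :
  (r < 5)%N -> (s < 5)%N -> fsub r (qv ^+ s * fexp f) = if r == s then f else 0.
Proof.
move=> r5 s5; apply: fpsP => n.
rewrite -[LHS]/((qv ^+ s * fexp f) (5 * n + r)%N) coefs_qvXM.
case: (ltnP (5 * n + r) s) => ns; first by rewrite ifF //; lia.
have [rs|rs] := leqP s r.
  rewrite -addnBA // coefs_fexp; last by lia.
  have -> : (r - s == 0)%N = (r == s) by rewrite subn_eq0 eqn_leq rs andbT.
  by case: ifP.
have -> : (5 * n + r - s = 5 * n.-1 + (5 + r - s))%N by lia.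
by rewrite coefs_fexp ?ifF //; lia.
Qed.

Lemma fsub_fexp r f : (r < 5)%N -> fsub r (fexp f) = if r == 0%N then f else 0.
Proof.
by move=> r5; apply: fpsP => n; rewrite -[LHS]/(fexp f (5 * n + r)%N) coefs_fexp //; case: ifP.
Qed.

Lemma fsub0_qvX_fexp k r f :
  (r < 5)%N -> fsub 0 (qv ^+ (5 * k + r) * fexp f) = if r == 0%N then qv ^+ k * f else 0.
Proof.
move=> r5; rewrite exprD exprM -fexp_qv -rmorphXn -mulrA fsub_fexpM //=.
case: eqP => [->|/eqP rn0]; first by rewrite mul1r fsub_fexp.
rewrite [X in _ * X](_ : _ = 0) ?mulr0 //; apply: fpsP => n.
rewrite -[LHS]/((qv ^+ r * fexp f) (5 * n + 0)%N) coefs_qvXM; case: ltnP => // ri.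
have -> : (5 * n + 0 - r = 5 * n.-1 + (5 - r))%N by lia.
by rewrite coefs_fexp ?ifF //; lia.
Qed.

Lemma fps_dissect5 f : f = \sum_(r < 5) qv ^+ r * fexp (fsub r f).
Proof.
apply: fpsP => n; rewrite coefs_sum.
have [m [s [s5 ->]]] : exists m s, (s < 5)%N /\ n = (5 * m + s)%N.
  by exists (n %/ 5)%N, (n %% 5)%N; lia.
rewrite (bigD1 (Ordinal s5)) // coefs_qvXM [nat_of_ord _]/= addnK ifF; last by lia.
rewrite -[X in fexp _ X]addn0 coefs_fexp // big1 => [|i /andP[_ ni]]; first exact/esym/addr0.
rewrite coefs_qvXM; case: ltnP => // li; rewrite /= ifF //.
move: ni; rewrite -val_eqE /=; move: (ltn_ord i); lia.
Qed.

End FpsRing.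

Arguments qv {R}.

(** * The Euler product *)

Section Euler.
Variable R : comNzRingType.
Implicit Types f g h : fps R.

Definition qpoch n : fps R := \prod_(i < n) (1 - qv ^+ i.+1).
(** The factors after the n-th are 1 modulo q^(n+1), so the diagonal coefficients are those of the
    infinite product. *)
Definition euler : fps R := Fps (fun n => qpoch n n).
(** Cutting the geometric series at k = n matches the range of multiplicities in
    [colored2_partitions]. *)
Definition qpochV n : fps R := \prod_(i < n) \sum_(k < n.+1) qv ^+ (k * i.+1).
Definition eulerV : fps R := Fps (fun n => qpochV n n).

Lemma qpochS n : qpoch n.+1 = qpoch n * (1 - qv ^+ n.+1).
Proof. by rewrite /qpoch big_ord_recr. Qed.

Lemma eqm_1Bqv n k : (n <= k)%N -> @eqm R n (1 - qv ^+ k) 1.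
Proof.
move=> nk; rewrite -{2}[1]subr0; apply: eqmD => //; apply: eqmN.
by rewrite -[qv ^+ k]mulr1; apply: eqm_qvX0.
Qed.

Lemma eqm_qpoch n m : (n <= m)%N -> eqm n.+1 (qpoch m) (qpoch n).
Proof.
elim: m => [|m IH]; first by rewrite leqn0 => /eqP->.
rewrite leq_eqVlt => /predU1P[->|nm] //.
rewrite qpochS -[qpoch n]mulr1; apply: eqmM; first exact: IH.
by apply: eqm_1Bqv; apply: nm.
Qed.

Lemma eqm_euler n m : (n <= m.+1)%N -> eqm n euler (qpoch m).
Proof. by move=> nm i ni; rewrite /= -(@eqm_qpoch i m) //; lia. Qed.

Lemma eqm_qpochV n : eqm n.+1 (qpochV n * qpoch n) 1.
Proof.
rewrite /qpochV /qpoch -big_split.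
apply: (@eqm_trans _ _ (\prod_(i < n) 1)); last by rewrite big1.
apply: eqm_prod => i _ /=.
under eq_bigr => k _ do rewrite mulnC exprM.
rewrite mulrC -[1 - _]opprB mulNr -subrX1 opprB -exprM.
by apply: eqm_1Bqv; lia.
Qed.

(** Modulo q^(i+1), both [qpochV i] and [qpochV n] invert the same product, and inverses are
    unique. *)
Lemma eqm_eulerV n : eqm n.+1 eulerV (qpochV n).
Proof.
move=> i ni; rewrite /=.
have H : eqm i.+1 (qpochV i) (qpochV n).
  apply: (@eqm_trans _ _ (qpochV i * (qpochV n * qpoch n))).
    rewrite -{1}[qpochV i]mulr1; apply: eqmM => //; apply: eqm_sym.
    exact: (eqm_le ni (@eqm_qpochV n)).
  apply: (@eqm_trans _ _ (qpochV n * (qpochV i * qpoch i))).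
    rewrite mulrCA; apply: eqmM => //; apply: eqmM => //; exact: eqm_qpoch.
  by rewrite -[X in eqm _ _ X]mulr1; apply: eqmM => //; apply: eqm_qpochV.
exact: H.
Qed.

Lemma eulerVK : eulerV * euler = 1.
Proof.
apply: eqm_eq => -[|n] //; apply: eqm_trans (@eqm_qpochV n).
by apply: eqmM; [apply: eqm_eulerV | apply: eqm_euler].
Qed.

(** Distributing the product over the sums gives one monomial for each multiplicity function, with
    the number being partitioned as exponent. *)
Lemma p_minus2_coef n : (p_minus2 n)%:R = (eulerV ^+ 2) n :> R.
Proof.
have -> : (eulerV ^+ 2) n = (qpochV n ^+ 2) n.
  by apply: (@eqmX _ n.+1) => //; apply: eqm_eulerV.
have -> : qpochV n ^+ 2 = \prod_(x : 'I_2 * 'I_n) \sum_(k < n.+1) qv ^+ (k * x.2.+1).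
  by rewrite -(pair_bigA _ (fun _ (i : 'I_n) => \sum_(k < n.+1) qv ^+ (k * i.+1))) prodr_const card_ord.
rewrite bigA_distr_bigA coefs_sum /=.
rewrite /p_minus2 -sum1_card natr_sum big_mkcond; apply: eq_bigr => m _.
by rewrite -expr_sum coefs_qvX inE eq_sym; case: eqP.
Qed.

End Euler.
Arguments euler {R}.
Arguments eulerV {R}.

(** * The pentagonal number theorem *)

Definition tri s := 'C(s.+1, 2).

Lemma triS s : tri s.+1 = (tri s + s.+1)%N.
Proof. by rewrite /tri binS bin1 addnC. Qed.

Lemma double_tri s : (2 * tri s = s * s.+1)%N.
Proof. by elim: s => // s IH; rewrite triS; lia. Qed.

(* These are s (3 s + 1) / 2 and (s + 1) (3 s + 2) / 2, the generalized pentagonal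
   numbers of indices - s and s + 1. *)
Definition pent1 s := (tri s + s * s)%N.
Definition pent2 s := (tri s + s.+1 * s.+1)%N.

Section Pentagonal.
Variable R : comNzRingType.

Definition pent_sum N : fps R :=
  \sum_(s < N) (-1) ^+ s * (qv ^+ pent1 s - qv ^+ pent2 s).

(** For s <= n this is the quotient of [qpoch n] by [qpoch s], written without division. *)
Definition qpochr s n : fps R := \prod_(s <= i < n) (1 - qv ^+ i.+1).

(* Shanks' finite form of Euler's identity: the term s = 0 of [shanks_sum n] is the
   product, and the other terms are divisible by q^n. *)
Definition shanks_term s n : fps R := (-1) ^+ s * qpochr s n * qv ^+ tri s.
Definition shanks_sum n := \sum_(s < n.+1) shanks_term s n * qv ^+ (s * n).

(** The summand is the change of the s-th term of [shanks_sum] when n grows by one, because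
    [qpochr s n] gains the factor 1 - q^(n+1). *)
Lemma shanks_telescope n k : (k <= n)%N ->
  \sum_(s < k.+1) shanks_term s n * (qv ^+ (s * n.+1) - qv ^+ (s.+1 * n.+1) - qv ^+ (s * n))
  = - (shanks_term k n * qv ^+ (k.+1 * n.+1)).
Proof.
elim: k => [|k IH] kn; first by rewrite big_ord1 !mul0n mul1n; ring.
rewrite big_ord_recr /= {}IH 1?ltnW // /shanks_term.
rewrite [qpochr k n]/qpochr big_ltn // -/(qpochr k.+1 n) triS.
rewrite [(k.+1 * n.+1)%N]mulnS [qv ^+ (k.+1 + _)]exprD [qv ^+ (tri k + _)]exprD [(-1) ^+ k.+1]exprS.
move: (qv ^+ (k.+1 * n)) (qv ^+ (k.+2 * n.+1)) (qv ^+ tri k) (qv ^+ k.+1) ((-1) ^+ k) => *; ring.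
Qed.

Lemma shanks_sumE n : shanks_sum n = pent_sum n + (-1) ^+ n * qv ^+ pent1 n.
Proof.
elim: n => [|n IH].
  rewrite /shanks_sum /pent_sum big_ord1 big_ord0 /shanks_term /qpochr big_geq //.
  by rewrite /pent1; ring.
have D : shanks_sum n.+1 - shanks_sum n = (-1) ^+ n.+1 * qv ^+ pent1 n.+1 - (-1) ^+ n * qv ^+ pent2 n.
  rewrite /shanks_sum big_ord_recr /= addrAC -sumrB.
  rewrite (eq_bigr (fun s : 'I_n.+1 => shanks_term s n *
      (qv ^+ (s * n.+1) - qv ^+ (s.+1 * n.+1) - qv ^+ (s * n)))); last first.
    move=> s _; rewrite /shanks_term /qpochr big_nat_recr /=; last by rewrite -ltnS.
    rewrite [(s.+1 * _)%N]mulSn [qv ^+ (n.+1 + _)]exprD; ring.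
  rewrite shanks_telescope // /shanks_term /qpochr !big_geq // /pent1 /pent2 (exprD _ (tri n)) (exprD _ (tri n.+1)).
  move: (qv ^+ tri n) (qv ^+ tri n.+1) (qv ^+ (n.+1 * n.+1)) ((-1) ^+ n) ((-1) ^+ n.+1) => *; ring.
by rewrite -[LHS](subrK (shanks_sum n)) D IH /pent_sum big_ord_recr /=; ring.
Qed.

Lemma eqm_pent_sum n : eqm n euler (pent_sum n).
Proof.
apply: (@eqm_trans _ _ (shanks_sum n)).
  apply: (@eqm_trans _ _ (qpoch R n)); first exact: eqm_euler.
  rewrite /shanks_sum big_ord_recl -[qpoch R n]addr0; apply: eqmD.
    rewrite /shanks_term mul0n /qpochr big_mkord -/(qpoch R n) /tri bin_small //.
    by rewrite !expr0 !mulr1 mul1r.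
  apply: (@eqm_trans _ _ (\sum_(i < n) 0)); first by rewrite big1.
  apply: eqm_sum => s _.
  by apply: eqm_sym; rewrite mulrC; apply: eqm_qvX0; rewrite lift0 mulSn leq_addr.
rewrite shanks_sumE -{2}[pent_sum n]addr0; apply: eqmD => //.
by rewrite mulrC; apply: eqm_qvX0; rewrite /pent1; nia.
Qed.

Lemma coefs_signM (f : fps R) s n : ((-1) ^+ s * f) n = (-1) ^+ s * f n.
Proof. by elim: s => [|s IH]; rewrite ?mul1r // !exprS -!mulrA !mulN1r coefsN IH. Qed.

Lemma coefs_pent_sum N m :
  pent_sum N m = \sum_(s < N) (-1) ^+ s * ((m == pent1 s)%:R - (m == pent2 s)%:R).
Proof.
rewrite coefs_sum; apply: eq_bigr => s _.
by rewrite coefs_signM coefsB !coefs_qvX.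
Qed.

Lemma coefs_euler N m : (m < N)%N ->
  euler m = \sum_(s < N) (-1) ^+ s * ((m == pent1 s)%:R - (m == pent2 s)%:R) :> R.
Proof. by move=> mN; rewrite (@eqm_pent_sum N) // coefs_pent_sum. Qed.

Lemma coefs_euler5 n r : (r < 5)%N ->
  euler (5 * n + r) = \sum_(k < n.+1) (-1) ^+ k * \sum_(s < 5)
   (-1) ^+ s * ((5 * n + r == pent1 (5 * k + s))%N%:R - (5 * n + r == pent2 (5 * k + s))%N%:R) :> R.
Proof.
move=> r5; rewrite (@coefs_euler (5 * n.+1)); last by lia.
pose F s : R := (-1) ^+ s * ((5 * n + r == pent1 s)%N%:R - (5 * n + r == pent2 s)%N%:R).
rewrite (sum5 F); apply: eq_bigr => k _; rewrite mulr_sumr; apply: eq_bigr => s _.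
by rewrite /F exprD exprM -signr_odd mulrA.
Qed.

(** Generalized pentagonal numbers are 0, 1 or 2 modulo 5. *)
Lemma fsub_euler_eq0 r : (2 < r < 5)%N -> fsub r (@euler R) = 0.
Proof.
move=> /andP[r2 r5]; apply: fpsP => n; rewrite -[LHS]/(euler (5 * n + r)%N) coefs_euler5 // big1 // => k _.
rewrite big1 ?mulr0 // => s _.
have := double_tri (5 * k + s).
rewrite /pent1 /pent2 => H; move: (ltn_ord s) => s5.
have [-> ->] : (5 * n + r == tri (5 * k + s) + (5 * k + s) * (5 * k + s))%N = false /\
 (5 * n + r == tri (5 * k + s) + (5 * k + s).+1 * (5 * k + s).+1)%N = false.
  case: s s5 H => -[|[|[|[|[|]]]]] // ? _ /= H; split; lia.
by rewrite subrr mulr0.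
Qed.

(** The generalized pentagonal numbers that are 1 modulo 5 are [pent2 (5 * k)], which is 25
    [pent1 k] + 1, and [pent1 (5 * k + 4)], which is 25 [pent2 k] + 1. The section is therefore the
    pentagonal series again, in q^5 and with opposite signs. *)
Lemma fsub1_euler : fsub 1 (@euler R) = - fexp euler.
Proof.
apply: fpsP => n; rewrite -[LHS]/(euler (5 * n + 1)%N) coefs_euler5 // coefsN coefs_fexpE.
have E (k : nat) : \sum_(s < 5)
   (-1) ^+ s * ((5 * n + 1 == pent1 (5 * k + s))%N%:R - (5 * n + 1 == pent2 (5 * k + s))%N%:R)
   = (n == 5 * pent2 k)%N%:R - (n == 5 * pent1 k)%N%:R :> R.
  rewrite !big_ord_recr big_ord0 /=.
  have := double_tri k; have := double_tri (5 * k); have := double_tri (5 * k + 1).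
  have := double_tri (5 * k + 2); have := double_tri (5 * k + 3); have := double_tri (5 * k + 4).
  rewrite addn0 /pent1 /pent2 => H4 H3 H2 H1 H0 H.
  repeat match goal with |- context [(5 * n + 1 == ?y)%N] =>
     first [have -> : (5 * n + 1 == y)%N = false by lia
           |have -> : (5 * n + 1 == y)%N = (n == 5 * (tri k + k * k))%N by lia
           |have -> : (5 * n + 1 == y)%N = (n == 5 * (tri k + k.+1 * k.+1))%N by lia] end.
  ring.
under eq_bigr => k _ do rewrite E.
case: ifPn => [/dvdnP[m ->]|n5].
  rewrite mulnK // (@coefs_euler (m * 5).+1); last by lia.
  rewrite -sumrN; apply: eq_bigr => k _; rewrite -mulrN opprB ![(5 * _)%N]mulnC !eqn_pmul2r //.
rewrite big1 ?oppr0 // => k _.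
have [-> ->] : (n == 5 * pent1 k)%N = false /\ (n == 5 * pent2 k)%N = false by lia.
by rewrite subrr mulr0.
Qed.

End Pentagonal.

(** * Jacobi's identity for the cube of the Euler product *)

(* The triangular number (j - b) (j - b - 1) / 2. *)
Definition jexp j b := if (j <= b)%N then tri (b - j) else tri (j - b).-1.

Lemma jexpS b j : (b.+1 + jexp j.+1 b = jexp j b + j.+1)%N.
Proof.
rewrite /jexp; case: (ltngtP j b) => jb.
- by rewrite (_ : b - j = (b - j.+1).+1)%N ?triS; lia.
- by rewrite (_ : (j.+1 - b).-1 = (j - b).-1.+1)%N ?triS; lia.
- by rewrite jb subnn subSnn addnC.
Qed.

Section Jacobi.
Variable R : comNzRingType.
Implicit Types f g h : fps R.
Local Notation q := (@qv R).

(** Pascal's rule defines the Gaussian binomial coefficients without division. *)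
Fixpoint qbin m j : fps R :=
  match m, j with
  | _, 0 => 1
  | 0, _.+1 => 0
  | m'.+1, j'.+1 => qbin m' j' + q ^+ j * qbin m' j
  end.

Lemma qbin0 m : qbin m 0 = 1. Proof. by case: m. Qed.

Lemma qbinS m j : qbin m.+1 j.+1 = qbin m j + q ^+ j.+1 * qbin m j.+1.
Proof. by []. Qed.

Lemma qbin_small m j : (m < j)%N -> qbin m j = 0.
Proof.
elim: m j => [|m IH] [|j] // mj; rewrite qbinS !IH ?mulr0 ?addr0 //; exact: ltnW.
Qed.

Lemma qbin_qpoch m j : (j <= m)%N -> qbin m j * qpoch R j * qpoch R (m - j) = qpoch R m.
Proof.
elim: m j => [|m IH] [|j] //; rewrite ?subn0 ?[qpoch R 0]/qpoch ?big_ord0 ?qbin0 ?mul1r //.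
rewrite ltnS subSS qbinS leq_eqVlt => /predU1P[->|jm].
  by rewrite (qbin_small (ltnSn m)) mulr0 addr0 !qpochS mulrA -[in RHS](IH m) // mulrAC.
have [IH1 IH2] := (IH _ (ltnW jm), IH _ jm); move: IH1 IH2.
rewrite -(subnSK jm) !qpochS => IH1 IH2.
have -> : q ^+ m.+1 = q ^+ j.+1 * q ^+ (m - j.+1).+1 by rewrite -exprD; congr (_ ^+ _); lia.
transitivity (qpoch R m * (1 - q ^+ j.+1) + q ^+ j.+1 * (qpoch R m * (1 - q ^+ (m - j.+1).+1))); last by ring.
by rewrite -{1}IH1 -IH2; ring.
Qed.

(* A finite form of Jacobi's triple product.  Its first factor vanishes at 1 when
   a > 0, so for (a, b) = (n + 1, n) the derivative at 1 is, up to sign, the square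
   of [qpoch n]. *)
Definition jtp_poly a b : {poly fps R} :=
  \prod_(l < a) (1 - (q ^+ l)%:P * 'X) * \prod_(l < b) ((q ^+ l.+1)%:P - 'X).

(** This is the q-binomial theorem. The shift r lets the induction peel off the first factor, which
    replaces r by r + 1. *)
Lemma coef_qbinom r a j :
  (\prod_(l < a) (1 - (q ^+ (l + r))%:P * 'X))`_j = (-1) ^+ j * q ^+ (r * j + tri j.-1) * qbin a j.
Proof.
elim: a r j => [|a IH] r j.
  rewrite big_ord0 coef1; case: j => [|j]; last by rewrite mulr0.
  by rewrite muln0 !mulr1.
rewrite big_ord_recl /= add0n mulrBl mul1r coefB -[_ * 'X * _]mulrA coefCM coefXM.
rewrite (eq_bigr (fun l : 'I_a => 1 - (q ^+ (l + r.+1))%:P * 'X)); last first.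
  by move=> l _; rewrite addSnnS.
case: j => [|j] /=.
  by rewrite IH mulr0 subr0 !qbin0 !muln0.
have -> : (r * j.+1 + tri j = r + (r.+1 * j + tri j.-1))%N by case: j => [|j]; rewrite ?triS /=; lia.
rewrite !IH /= [X in _ - X = _](_ : _ = q ^+ r * ((-1) ^+ j * q ^+ (r.+1 * j + tri j.-1) * qbin a j)) //.
have -> : (r.+1 * j.+1 + tri j = j.+1 + (r + (r.+1 * j + tri j.-1)))%N by case: j => [|j]; rewrite ?triS /=; lia.
move: (r.+1 * j + tri j.-1)%N => e; rewrite ![q ^+ (_ + _)]exprD [(-1) ^+ j.+1]exprS.
move: (q ^+ j.+1) => u; ring.
Qed.

Lemma coef_jtp a b j :
  (jtp_poly a b)`_j = (-1) ^+ j * q ^+ jexp j b * qbin (a + b) j.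
Proof.
rewrite /jtp_poly; elim: b j => [|b IH] j.
  rewrite big_ord0 mulr1 addn0.
  have := coef_qbinom 0 a j; under eq_bigr do rewrite addn0.
  by move=> ->; rewrite mul0n; case: j => [|j] //; rewrite /jexp subn0.
rewrite big_ord_recr /= mulrA mulrBr coefB mulrC coefCM coefMX addnS.
case: j => [|j] /=.
  have -> : jexp 0 b.+1 = (b.+1 + jexp 0 b)%N by rewrite /jexp /= !subn0 triS addnC.
  rewrite IH !qbin0 subr0 [q ^+ (_ + _)]exprD; move: (q ^+ b.+1) => u; ring.
rewrite !IH.
have -> : jexp j.+1 b.+1 = jexp j b by rewrite /jexp !subSS.
rewrite (_ : q ^+ b.+1 * _ = (-1) ^+ j.+1 * (q ^+ b.+1 * q ^+ jexp j.+1 b) * qbin (a + b) j.+1).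
  by rewrite -exprD jexpS exprD [(-1) ^+ j.+1]exprS; move: (q ^+ j.+1) => u; ring.
by rewrite !mulrA; congr (_ * _ * _); rewrite mulrC.
Qed.

(** A Gaussian binomial far from both ends is close to the inverse Euler product; near an end the
    approximation is weaker, but the power q^[jexp j n] makes up for it. *)
Lemma eqm_qbin_euler n j :
  (j <= n.*2.+1)%N -> eqm n (q ^+ jexp j n * (qbin n.*2.+1 j * euler)) (q ^+ jexp j n).
Proof.
move=> jn; rewrite -[X in eqm _ _ X]mulr1.
have tri_ge k : (k <= tri k)%N by have := double_tri k; nia.
pose M := (minn j (n.*2.+1 - j)).+1.
have jM : (n <= jexp j n + M)%N.
  rewrite /M /jexp; case: (leqP j n) => [jn'|nj]; first by have := tri_ge (n - j)%N; lia.
  by have := tri_ge (j - n).-1; lia.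
apply: (eqm_qvXM jM).
have E k : (M <= k.+1)%N -> eqm M euler (qpoch R k) by apply: eqm_euler.
have H : eqm M (qbin n.*2.+1 j * euler * euler) euler.
  apply: (@eqm_trans _ _ (qbin n.*2.+1 j * qpoch R j * qpoch R (n.*2.+1 - j))).
    by apply: eqmM; [apply: eqmM => // |]; apply: E; rewrite /M; lia.
  by rewrite qbin_qpoch //; apply: eqm_sym; apply: E; rewrite /M; lia.
rewrite (_ : qbin _ _ * _ = eulerV * (qbin n.*2.+1 j * euler * euler)); last first.
  by rewrite [RHS]mulrCA eulerVK mulr1.
by rewrite -(eulerVK R); apply: eqmM.
Qed.

Lemma horner_deriv_1BX (p : {poly fps R}) : ((1 - 'X) * p)^`().[1] = - p.[1].
Proof.
rewrite derivM derivB derivX -polyC1 derivC hornerD !hornerM !hornerD !hornerN !hornerC hornerX.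
by rewrite ?hornerC add0r subrr mul0r addr0 mulN1r.
Qed.

Lemma horner_deriv_jtp n : (jtp_poly n.+1 n)^`().[1] = (-1) ^+ n.+1 * qpoch R n ^+ 2.
Proof.
rewrite /jtp_poly big_ord_recl expr0 mul1r -mulrA horner_deriv_1BX hornerM !horner_prod.
rewrite -[in LHS]mulN1r exprS -[RHS]mulrA; congr (_ * _).
rewrite expr2 mulrCA; congr (_ * _).
  by apply: eq_bigr => i _; rewrite hornerD hornerN hornerM !hornerC hornerX mulr1.
rewrite (eq_bigr (fun i : 'I_n => -1 * (1 - q ^+ i.+1))) => [|i _].
  by rewrite big_split /= prodr_const card_ord.
by rewrite hornerD hornerN hornerC hornerX mulN1r opprB.
Qed.

Lemma qpoch_sqr n : (-1) ^+ n.+1 * qpoch R n ^+ 2 =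
  \sum_(j < n.*2.+1) (-1) ^+ j.+1 * (q ^+ jexp j.+1 n * qbin n.*2.+1 j.+1) *+ j.+1.
Proof.
have an : (n.+1 + n = n.*2.+1)%N by lia.
rewrite -horner_deriv_jtp (@horner_coef_wide _ n.*2.+1).
  by apply: eq_bigr => j _; rewrite expr1n mulr1 coef_deriv coef_jtp an mulrA.
apply/leq_sizeP => j nj.
by rewrite coef_deriv coef_jtp an qbin_small ?mulr0 ?mul0rn.
Qed.

(** One more Euler product turns every Gaussian binomial in [qpoch_sqr] into 1 modulo q^n, which
    leaves Jacobi's series. *)
Lemma eqm_euler_cube n : eqm n ((-1) ^+ n.+1 * euler ^+ 3)
  (\sum_(j < n.*2.+1) (-1) ^+ j.+1 * q ^+ jexp j.+1 n *+ j.+1).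
Proof.
apply: (@eqm_trans _ _ ((-1) ^+ n.+1 * qpoch R n ^+ 2 * euler)).
  rewrite [euler ^+ 3]exprSr mulrA; apply: eqmM => //; apply: eqmM => //.
  by apply: eqmX; apply: eqm_euler.
rewrite qpoch_sqr mulr_suml; apply: eqm_sum => j _.
rewrite mulrnAl -[X in eqm _ X _]mulr_natr -[X in eqm _ _ X]mulr_natr; apply: eqmM => //.
by rewrite -!mulrA; apply: eqmM => //; apply: eqm_qbin_euler.
Qed.

(** The exponents in Jacobi's series are triangular numbers, which are 0, 1 or 3 modulo 5. *)
Lemma fsub2_euler_cube : fsub 2 (@euler R ^+ 3) = 0.
Proof.
apply: fpsP => m; set n := (5 * m + 3)%N.
have mn : (5 * m + 2 < n)%N by rewrite /n; lia.
have := eqm_euler_cube mn; rewrite coefs_signM coefs_sum big1 => [|j _].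
  move=> /(congr1 ( *%R ((-1) ^+ n.+1))).
  by rewrite mulrA -exprMn mulrNN mulr1 expr1n mul1r mulr0.
rewrite coefsMn coefs_signM coefs_qvX (_ : _ == _ = false) ?mulr0 ?mul0rn //.
rewrite /jexp; case: (leqP j.+1 n) => jn.
  have := double_tri (n - j.+1); have : exists k r, (r < 5)%N /\ (n - j.+1 = 5 * k + r)%N.
    by exists ((n - j.+1) %/ 5)%N, ((n - j.+1) %% 5)%N; lia.
  by move=> [k [r [r5 ->]]]; case: r r5 => [|[|[|[|[|r]]]]] // _; lia.
have := double_tri (j.+1 - n).-1; have : exists k r, (r < 5)%N /\ ((j.+1 - n).-1 = 5 * k + r)%N.
  by exists ((j.+1 - n).-1 %/ 5)%N, ((j.+1 - n).-1 %% 5)%N; lia.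
by move=> [k [r [r5 ->]]]; case: r r5 => [|[|[|[|[|r]]]]] // _; lia.
Qed.

End Jacobi.

(** * Norms over the series in q ^ 5 *)

Section Morphisms.
Variables R S : comNzRingType.
Implicit Types f g : fps R.

Definition fpsC (c : R) : fps R := Fps (fun n => if n == 0%N then c else 0).

Lemma coefs_fpsCM c f n : (fpsC c * f) n = c * f n.
Proof.
rewrite coefsM big_ord_recl subn0 /= big1 ?addr0 // => i _; exact: mul0r.
Qed.

Lemma fpsC_zmod : zmod_morphism fpsC.
Proof. by move=> c d; apply: fpsP => n; rewrite coefsB /=; case: ifP; rewrite ?subrr. Qed.

Lemma fpsC_monoid : monoid_morphism fpsC.
Proof.
split; first by apply: fpsP => n; rewrite coefs1 /=; case: eqP.
move=> c d; apply: fpsP => n; rewrite coefs_fpsCM /=.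
by case: ifP => //; rewrite mulr0.
Qed.

(** The substitution of z q for q; for a fifth root of unity z it is a conjugation over the series
    in q^5. *)
Definition dil (z : R) f : fps R := Fps (fun n => z ^+ n * f n).

Lemma dil_zmod z : zmod_morphism (dil z).
Proof. by move=> f g; apply: fpsP => n; rewrite coefsB /= -mulrBr. Qed.

Lemma dil_monoid z : monoid_morphism (dil z).
Proof.
split; first by apply: fpsP => -[|n]; rewrite coefs1 /= ?mulr1 ?mulr0.
move=> f g; apply: fpsP => n; rewrite [LHS]/= !coefsM mulr_sumr; apply: eq_bigr => i _.
have -> : z ^+ n = z ^+ i * z ^+ (n - i) by rewrite -exprD subnKC // -ltnS.
by rewrite /=; ring.
Qed.

Lemma dil_qv z : dil z qv = fpsC z * qv.
Proof.
apply: fpsP => n; rewrite coefs_fpsCM /=.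
by case: (n =P 1%N) => [->|]; rewrite ?mulr0.
Qed.

Lemma dil_fexp z f : z ^+ 5 = 1 -> dil z (fexp f) = fexp f.
Proof.
move=> z5; apply: fpsP => n; rewrite [LHS]/= coefs_fexpE.
by case: ifP => [/dvdnP[k ->]|_]; rewrite ?mulr0 // mulnC exprM z5 expr1n mul1r.
Qed.

Lemma eqm_dil z n f g : eqm n f g -> eqm n (dil z f) (dil z g).
Proof. by move=> fg i i_n; rewrite /= fg. Qed.

Lemma eqm_fexp n f g : eqm n f g -> eqm n (fexp f) (fexp g).
Proof. by move=> fg i i_n; rewrite /=; case: ifP => // _; apply: fg; lia. Qed.

Variable phi : {rmorphism R -> S}.

Definition fmap f : fps S := Fps (fun n => phi (f n)).

Lemma fmap_zmod : zmod_morphism fmap.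
Proof. by move=> f g; apply: fpsP => n; rewrite coefsB /= rmorphB. Qed.

Lemma fmap_monoid : monoid_morphism fmap.
Proof.
split; first by apply: fpsP => n; rewrite coefs1 /= rmorph_nat.
move=> f g; apply: fpsP => n; rewrite [LHS]/= !coefsM rmorph_sum; apply: eq_bigr => i _.
by rewrite /= rmorphM.
Qed.

Lemma fmap_qv : fmap qv = qv.
Proof. by apply: fpsP => n; rewrite /= rmorph_nat. Qed.

Lemma fmap_fexp f : fmap (fexp f) = fexp (fmap f).
Proof. by apply: fpsP => n; rewrite /=; case: ifP => // _; rewrite rmorph0. Qed.

End Morphisms.

HB.instance Definition _ (R : comNzRingType) :=
  GRing.isZmodMorphism.Build _ _ (@fpsC R) (@fpsC_zmod R).
HB.instance Definition _ (R : comNzRingType) :=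
  GRing.isMonoidMorphism.Build _ _ (@fpsC R) (@fpsC_monoid R).
HB.instance Definition _ (R : comNzRingType) z :=
  GRing.isZmodMorphism.Build _ _ (@dil R z) (@dil_zmod R z).
HB.instance Definition _ (R : comNzRingType) z :=
  GRing.isMonoidMorphism.Build _ _ (@dil R z) (@dil_monoid R z).
HB.instance Definition _ (R S : comNzRingType) (phi : {rmorphism R -> S}) :=
  GRing.isZmodMorphism.Build _ _ (fmap phi) (fmap_zmod phi).
HB.instance Definition _ (R S : comNzRingType) (phi : {rmorphism R -> S}) :=
  GRing.isMonoidMorphism.Build _ _ (fmap phi) (fmap_monoid phi).

Lemma fmap_euler (R S : comNzRingType) (phi : {rmorphism R -> S}) : fmap phi euler = euler.
Proof.
apply: fpsP => n; rewrite -[RHS]/(qpoch S n n) -[LHS]/(fmap phi (qpoch R n) n); congr (coefs _ _).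
rewrite rmorph_prod; apply: eq_bigr => i _.
by rewrite rmorphB rmorph1 rmorphXn /= fmap_qv.
Qed.

(** * Fifth roots of unity and products of conjugates *)

Section RootOfUnity.
Variables (S : comNzRingType) (w : S).
Hypothesis w0 : 1 + w + w ^+ 2 + w ^+ 3 + w ^+ 4 = 0.

Lemma root5_exp : w ^+ 5 = 1.
Proof.
by apply/eqP; rewrite -subr_eq0 subrX1 !big_ord_recr big_ord0 /= add0r w0 mulr0.
Qed.

(** The Gauss periods w + w^4 and w^2 + w^3 are the roots of X^2 + X - 1. Pairing the factors k and
    5 - k makes the products below symmetric in the two periods. *)
Lemma root5_sum : (w + w ^+ 4) + (w ^+ 2 + w ^+ 3) = -1.
Proof. by rewrite -[RHS]addr0 -w0; ring. Qed.

Lemma root5_prod : (w + w ^+ 4) * (w ^+ 2 + w ^+ 3) = -1.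
Proof.
transitivity (w ^+ 3 + w ^+ 4 + w ^+ 5 * w + w ^+ 5 * w ^+ 2); first by ring.
by rewrite root5_exp -[RHS]addr0 -w0; ring.
Qed.

Lemma prod_1B_root5 u : \prod_(k < 5) (1 - w ^+ k * u) = 1 - u ^+ 5.
Proof.
set s := w + w ^+ 4; set s' := w ^+ 2 + w ^+ 3.
transitivity ((1 - u) * (1 - s * u + w ^+ 5 * u ^+ 2) * (1 - s' * u + w ^+ 5 * u ^+ 2)).
  by rewrite !big_ord_recr big_ord0 /= /s /s'; ring.
transitivity ((1 - u) * (1 - (s + s') * u + (2 + s * s') * u ^+ 2 - (s + s') * u ^+ 3 + u ^+ 4)).
  by rewrite root5_exp; ring.
by rewrite root5_sum root5_prod; ring.
Qed.

(* Multiplied by A ^+ 4, the hypothesis [A * C = B ^+ 2] turns both sides into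
   polynomials in A, [q * A * B] and [q ^+ 2 * B ^+ 2]. *)
Lemma prod_dissect5 (q A B C : S) : A * C = B ^+ 2 ->
  let e k := A - w ^+ k * q * B - w ^+ k ^+ 2 * q ^+ 2 * C in
  let E := A - q * B - q ^+ 2 * C in
  A ^+ 4 * (e 1%N * e 2%N * e 3%N * e 4%N) =
  A ^+ 4 * (E ^+ 4 + 5 * (q * B) * E ^+ 3 + 15 * (q * B) ^+ 2 * E ^+ 2
            + 25 * (q * B) ^+ 3 * E + 25 * (q * B) ^+ 4).
Proof.
move=> AC e E; set y := q * A * B; set x := q ^+ 2 * B ^+ 2.
have Ae k : A * e k = A ^+ 2 - w ^+ k * y - w ^+ k ^+ 2 * x.
  by rewrite /y /x -AC /e; ring.
have AE : A * E = A ^+ 2 - y - x by rewrite /y /x -AC /E; ring.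
set s := w + w ^+ 4; set s' := w ^+ 2 + w ^+ 3.
set K := A ^+ 4 + y ^+ 2 + x ^+ 2; set a := A ^+ 2 * y - x * y; set b := A ^+ 2 * x.
have P14 : (A * e 1%N) * (A * e 4%N) = K - s * a - s' * b.
  (* Factors w^5 are kept visible so that [root5_exp] can rewrite them to 1. *)
  transitivity (A ^+ 4 + w ^+ 5 * y ^+ 2 + w ^+ 5 * w ^+ 5 * x ^+ 2 - s * A ^+ 2 * y
    - (w ^+ 2 + w ^+ 5 * w ^+ 3) * b + (w ^+ 5 * w ^+ 4 + w ^+ 5 * w) * (x * y)).
    by rewrite !Ae /s /b; ring.
  by rewrite root5_exp /K /a /s /s' /b; ring.
have P23 : (A * e 2%N) * (A * e 3%N) = K - s' * a - s * b.
  transitivity (A ^+ 4 + w ^+ 5 * y ^+ 2 + w ^+ 5 * w ^+ 5 * x ^+ 2 - s' * A ^+ 2 * y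
    - (w ^+ 4 + w ^+ 5 * w) * b + (w ^+ 5 * w ^+ 2 + w ^+ 5 * w ^+ 3) * (x * y)).
    by rewrite !Ae /s' /b; ring.
  by rewrite root5_exp /K /a /s /s' /b; ring.
transitivity ((A * e 1%N) * (A * e 4%N) * ((A * e 2%N) * (A * e 3%N))); first by ring.
rewrite P14 P23.
transitivity (K ^+ 2 - K * (s + s') * (a + b) + (s * s') * (a ^+ 2 + b ^+ 2)
  + ((s + s') ^+ 2 - 2 * (s * s')) * a * b); first by ring.
rewrite root5_sum root5_prod.
transitivity ((A * E) ^+ 4 + 5 * y * (A * E) ^+ 3 + 15 * y ^+ 2 * (A * E) ^+ 2
  + 25 * y ^+ 3 * (A * E) + 25 * y ^+ 4); last by rewrite /y; ring.
by rewrite AE /K /a /b /y /x; ring.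
Qed.

End RootOfUnity.

Section Norm.
Variables (R : comNzRingType) (z : R).
Hypothesis z5 : 1 + z + z ^+ 2 + z ^+ 3 + z ^+ 4 = 0.

Lemma zX_sum i : ~~ (5 %| i)%N ->
  1 + z ^+ i + z ^+ i ^+ 2 + z ^+ i ^+ 3 + z ^+ i ^+ 4 = 0.
Proof.
rewrite (divn_eq i 5) exprD mulnC exprM (root5_exp z5) expr1n mul1r => i5.
have [] : (i %% 5 = 1 \/ i %% 5 = 2 \/ i %% 5 = 3 \/ i %% 5 = 4)%N by lia.
  by move=> ->.
by move=> [->|[->|->]]; rewrite -!exprM -[z ^+ (_ * 2)](expr_mod _ (root5_exp z5))
  -[z ^+ (_ * 3)](expr_mod _ (root5_exp z5)) -[z ^+ (_ * 4)](expr_mod _ (root5_exp z5)) -[RHS]z5 /=; ring.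
Qed.

Definition norm5 (f : fps R) := \prod_(k < 5) dil (z ^+ k) f.

Lemma norm5M : {morph norm5 : f g / f * g}.
Proof.
by move=> f g; rewrite /norm5 -big_split; apply: eq_bigr => k _; rewrite rmorphM.
Qed.


(** If 5 divides i, all conjugates coincide; otherwise z^i is again a root of 1 + X + X^2 + X^3 +
    X^4 and [prod_1B_root5] applies. *)
Lemma norm5_1Bqv i :
  norm5 (1 - qv ^+ i) = if (5 %| i)%N then (1 - qv ^+ i) ^+ 5 else 1 - qv ^+ (i * 5).
Proof.
have E k : dil (z ^+ k) (1 - qv ^+ i) = 1 - fpsC (z ^+ i) ^+ k * qv ^+ i.
  by rewrite rmorphB rmorph1 rmorphXn /= dil_qv exprMn -!rmorphXn -!exprM mulnC.
rewrite /norm5 (eq_bigr _ (fun (k : 'I_5) _ => E k)).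
case: ifPn => [/dvdnP[m ->]|i5].
  rewrite [(m * 5)%N]mulnC [z ^+ _]exprM (root5_exp z5) expr1n rmorph1.
  under eq_bigr => k _ do rewrite expr1n mul1r.
  by rewrite prodr_const card_ord.
by rewrite prod_1B_root5 ?exprM // -!rmorphXn -(rmorph1 (@fpsC R)) -!rmorphD zX_sum // rmorph0.
Qed.

(** In each block of five consecutive indices, the multiple of 5 contributes a fifth power in place
    of its factor of [fexp (qpoch R (5 * n))]; the extra product on the left supplies that
    factor. *)
Lemma norm5_qpoch n :
  norm5 (qpoch R (5 * n)) * fexp (fexp (qpoch R n)) = fexp (qpoch R (5 * n)) * fexp (qpoch R n) ^+ 5.
Proof.
have fexp_1B m : fexp (1 - qv ^+ m) = 1 - qv ^+ (5 * m) :> fps R.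
  by rewrite rmorphB rmorph1 rmorphXn /= fexp_qv exprM.
have -> : norm5 (qpoch R (5 * n)) = \prod_(i < 5 * n) norm5 (1 - qv ^+ i.+1).
  by apply: (big_morph _ norm5M); rewrite /norm5 big1 // => k _; rewrite rmorph1.
rewrite /qpoch !rmorph_prod /= (big5 _ (fun i => norm5 (1 - qv ^+ i.+1))).
rewrite (big5 _ (fun i => fexp (1 - qv ^+ i.+1))) -!prodrXl -!big_split; apply: eq_bigr => k _.
rewrite [in LHS]big_ord_recr [in RHS]big_ord_recr [nat_of_ord _]/=.
rewrite (eq_bigr (fun r : 'I_4 => fexp (1 - qv ^+ (5 * k + r).+1))) => [|r _]; last first.
  by rewrite norm5_1Bqv ifN ?fexp_1B 1?mulnC //; move: (ltn_ord r) => /=; lia.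
have -> : (5 * k + 4).+1 = (5 * k.+1)%N by lia.
have -> : norm5 (1 - qv ^+ (5 * k.+1)) = fexp (1 - qv ^+ k.+1) ^+ 5.
  by rewrite norm5_1Bqv dvdn_mulr // fexp_1B.
rewrite -(fexp_1B k.+1).
rewrite -[LHS]mulrA -[RHS]mulrA; congr (_ * _); exact: mulrC.
Qed.

Lemma norm5_euler : norm5 euler * fexp (fexp euler) = fexp euler ^+ 6.
Proof.
apply: eqm_eq => n.
apply: (@eqm_trans _ _ (norm5 (qpoch R (5 * n)) * fexp (fexp (qpoch R n)))).
  apply: eqmM; last by do 2!apply: eqm_fexp; apply: eqm_euler.
  by apply: eqm_prod => k _; apply: eqm_dil; apply: eqm_euler; lia.
rewrite norm5_qpoch [_ ^+ 6]exprS; apply: eqmM; last apply: eqmX.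
  by apply: eqm_fexp; apply: eqm_sym; apply: eqm_euler; lia.
by apply: eqm_fexp; apply: eqm_sym; apply: eqm_euler; lia.
Qed.

End Norm.

Lemma fps_mulI (R : comNzRingType) (f g : fps R) : f 0 = 1 -> f * g = 0 -> g = 0.
Proof.
move=> f0 fg; apply: eqm_eq; elim=> [|n IH] // i; rewrite ltnS leq_eqVlt => /predU1P[->|]; last exact: IH.
have := congr1 (fun h => coefs h n) fg; rewrite coefsM big_ord_recl f0 mul1r subn0 big1 ?addr0 //.
by move=> j _; rewrite IH ?coefs0 ?mulr0 //=; rewrite /bump /=; move: (ltn_ord j); lia.
Qed.

(** * The modular equation *)

Section Dissection.
Variable R : numDomainType.
Local Notation q := (@qv R).
Local Notation E := (@euler R).

Definition dis0 : fps R := fsub 0 E.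
Definition dis2 : fps R := - fsub 2 E.

Lemma euler_dissect : E = fexp dis0 - q * fexp (fexp E) - q ^+ 2 * fexp dis2.
Proof.
rewrite {1}(fps_dissect5 E) !big_ord_recr big_ord0 /= fsub1_euler (@fsub_euler_eq0 R 3) // (@fsub_euler_eq0 R 4) //.
by rewrite /dis2 !rmorphN rmorph0; ring.
Qed.

Lemma dis0_1 : dis0 0 = 1.
Proof. by rewrite /= /qpoch big_ord0 coefs1. Qed.

Lemma fsub2_sum (f0 f1 f2 f3 f4 : fps R) :
  fsub 2 (q ^+ 0 * fexp f0 + q ^+ 1 * fexp f1 + q ^+ 2 * fexp f2
          + q ^+ 3 * fexp f3 + q ^+ 4 * fexp f4) = f2.
Proof. by rewrite !raddfD /= !fsub_qvX_fexp //= !add0r !addr0. Qed.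

(** The exponents that are 2 modulo 5 in the cube of the dissection carry 3 A (B^2 - A C), which
    vanishes by [fsub2_euler_cube]; A has constant term 1 and can be cancelled. *)
Lemma dis02 : dis0 * dis2 = fexp E ^+ 2.
Proof.
have := fsub2_euler_cube R; rewrite {1}euler_dissect.
set a := dis0; set b := fexp E; set c := dis2.
have -> : (fexp a - q * fexp b - q ^+ 2 * fexp c) ^+ 3 =
    q ^+ 0 * fexp (a ^+ 3 - 3 * q * b * c ^+ 2)
  + q ^+ 1 * fexp (- 3 * a ^+ 2 * b - q * c ^+ 3)
  + q ^+ 2 * fexp (a * (3 * (b ^+ 2 - a * c)))
  + q ^+ 3 * fexp (- b ^+ 3 + 6 * a * b * c)
  + q ^+ 4 * fexp (3 * a * c ^+ 2 - 3 * b ^+ 2 * c).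
  rewrite !(rmorphD, rmorphN, rmorphM, rmorphXn, rmorph_nat) /= !fexp_qv; ring.
rewrite fsub2_sum => /(fps_mulI dis0_1) H.
(* The factor 3 is cancelled coefficientwise, in characteristic 0. *)
apply/eqP; rewrite eq_sym -subr_eq0; apply/eqP/fpsP => n.
have := congr1 (fun f => coefs f n) H; rewrite mulr_natl coefsMn => /eqP.
by rewrite mulrn_eq0 => /eqP.
Qed.

End Dissection.

(** The norm of the Euler product is computed twice: factor by factor in [norm5_euler], and from the
    5-dissection in [prod_dissect5], whose factor A^4 is cancelled by its constant term 1. *)
Lemma modular_eq_algC : let B := fexp (fexp euler) in
  euler * (euler ^+ 4 + 5 * (qv * B) * euler ^+ 3 + 15 * (qv * B) ^+ 2 * euler ^+ 2
     + 25 * (qv * B) ^+ 3 * euler + 25 * (qv * B) ^+ 4) * B = fexp euler ^+ 6 :> fps algC.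
Proof.
move=> B.
have [z zp] := C_prim_root_exists (isT : 0 < 5)%N.
have z0 : 1 + z + z ^+ 2 + z ^+ 3 + z ^+ 4 = 0.
  have z1 : z - 1 != 0 by rewrite subr_eq0 -[z]expr1 -(prim_order_dvd zp).
  have := subrX1 z 5; rewrite (prim_expr_order zp) subrr => /esym H.
  apply: (mulfI z1); rewrite mulr0 -[RHS]H !big_ord_recr big_ord0 /=; ring.
have w0 : 1 + fpsC z + fpsC z ^+ 2 + fpsC z ^+ 3 + fpsC z ^+ 4 = 0.
  by rewrite -!rmorphXn -(rmorph1 (@fpsC _)) -!rmorphD z0 rmorph0.
have AC : fexp (dis0 algC) * fexp (dis2 algC) = B ^+ 2 by rewrite -rmorphM dis02 rmorphXn.
rewrite -(norm5_euler z0); congr (_ * _).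
have dE k : dil (z ^+ k) euler = fexp (dis0 algC) - fpsC z ^+ k * qv * B
   - fpsC z ^+ k ^+ 2 * qv ^+ 2 * fexp (dis2 algC).
  have zk : (z ^+ k) ^+ 5 = 1 by rewrite exprAC (prim_expr_order zp) expr1n.
  rewrite {1}euler_dissect !rmorphB !rmorphM /= !dil_fexp // dil_qv rmorphXn; ring.
have coef0M (f g : fps algC) : f 0 = 1 -> g 0 = 1 -> (f * g) 0 = 1.
  by move=> f0 g0; rewrite coefsM big_ord1 f0 g0 mulr1.
have A0 : (fexp (dis0 algC) ^+ 4) 0 = 1.
  have A1 : fexp (dis0 algC) 0 = 1 by rewrite coefs_fexpE /= /qpoch big_ord0 coefs1.
  by rewrite !exprS expr0 mulr1; do !apply: (coef0M).
apply/eqP; rewrite -subr_eq0; apply/eqP/(fps_mulI A0).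
have := prod_dissect5 w0 qv AC; rewrite /= -!dE -euler_dissect => H.
rewrite mulrBr mulrCA -H mulrCA -mulrBr /norm5 !big_ord_recr big_ord0 /=.
have -> : dil (z ^+ 0) euler = euler.
  by apply: fpsP => n; rewrite /= expr0 expr1n mul1r.
rewrite [X in _ * X](_ : _ = 0) ?mulr0 //; ring.
Qed.

Lemma modular_eq : let B := fexp (fexp euler) in
  euler * (euler ^+ 4 + 5 * (qv * B) * euler ^+ 3 + 15 * (qv * B) ^+ 2 * euler ^+ 2
     + 25 * (qv * B) ^+ 3 * euler + 25 * (qv * B) ^+ 4) * B = fexp euler ^+ 6 :> fps int.
Proof.
have inj : injective (fmap (intr : {rmorphism int -> algC})).
  move=> f g fg; apply: fpsP => n; apply: (@intr_inj algC).
  exact: (congr1 (fun h => coefs h n) fg).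
move=> B; apply: inj; have := modular_eq_algC; rewrite /B.
by rewrite !(rmorphM, rmorphD, rmorphXn, rmorph_nat) /= !fmap_fexp !fmap_euler !fmap_qv.
Qed.

(** * The 5-section of powers of hx *)

Section Iteration.
Notation q := (@qv int).
Notation E := (@euler int).
Notation G := (@eulerV int).
Notation U := (@fsub int 0).
Notation E5 := (fexp E).
Notation G5 := (fexp G).
Notation E25 := (fexp (fexp E)).
Notation G25 := (fexp (fexp G)).

Lemma eulerK : G * E = 1. Proof. exact: eulerVK. Qed.
Lemma euler5K : G5 * E5 = 1. Proof. by rewrite -rmorphM eulerK rmorph1. Qed.
Lemma euler25K : G25 * E25 = 1. Proof. by rewrite -rmorphM euler5K rmorph1. Qed.

(* [hx], [ht], [hY] are the series x, t, Y of the introduction. *)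
Definition hx : fps int := q * E25 * G.
Definition ht : fps int := q * E5 ^+ 6 * G ^+ 6.
Definition hY : fps int := 1 + 5 * hx + 15 * hx ^+ 2 + 25 * hx ^+ 3 + 25 * hx ^+ 4.

Lemma mul_hY : E25 * hY = E5 ^+ 6 * G ^+ 5.
Proof.
rewrite -modular_eq /hY /hx; have := eulerK.
move: G E E25 => g e B ge.
transitivity (B * ((g * e) ^+ 5 + 5 * (q * B * g) * (g * e) ^+ 4 + 15 * (q * B * g) ^+ 2 * (g * e) ^+ 3
  + 25 * (q * B * g) ^+ 3 * (g * e) ^+ 2 + 25 * (q * B * g) ^+ 4 * (g * e))); last by ring.
by rewrite ge; ring.
Qed.

Lemma ht_hx : ht = hx * hY.
Proof. by rewrite /hx mulrAC -[q * _ * _]mulrA mul_hY /ht; ring. Qed.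

(* This is t(q^5) / x^i, a power series for i <= 5. *)
Definition hw i : fps int := q ^+ (5 - i) * E ^+ i * E25 ^+ (6 - i) * G5 ^+ 6.

Lemma fexp_ht : fexp ht = hw 0.
Proof. by rewrite /ht /hw !(rmorphXn, rmorphM) /= fexp_qv; ring. Qed.

(** This is the relation x^5 = t(q^5) Y divided by x^i. *)
Lemma hw_hY i : (i <= 5)%N -> hw i * hY = hx ^+ (5 - i).
Proof.
move=> i5; rewrite /hw /hx (_ : 6 - i = (5 - i).+1)%N; last by lia.
rewrite exprS.
transitivity (q ^+ (5 - i) * E ^+ i * E25 ^+ (5 - i) * G5 ^+ 6 * (E25 * hY)).
  by move: (E25 ^+ (5 - i)) (q ^+ (5 - i)) (E ^+ i) => *; ring.
rewrite mul_hY !exprMn.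
have -> : G ^+ 5 = G ^+ i * G ^+ (5 - i) by rewrite -exprD subnKC.
transitivity (q ^+ (5 - i) * E25 ^+ (5 - i) * G ^+ (5 - i) * (G * E) ^+ i * (G5 * E5) ^+ 6).
  rewrite !(exprMn _ G E) !(exprMn _ G5 E5).
  by move: (E25 ^+ (5 - i)) (q ^+ (5 - i)) (E ^+ i) (G ^+ i) (G ^+ (5 - i)) (G5 ^+ 6) (E5 ^+ 6) => *; ring.
by rewrite eulerK euler5K !expr1n !mulr1.
Qed.

Lemma hw_hx i : (i < 5)%N -> hw i.+1 * hx = hw i.
Proof.
move=> i5; rewrite -[RHS]mulr1 -eulerK /hw /hx.
by case: i i5 => [|[|[|[|[|]]]]] //= _; rewrite !(subSS, subn0); ring.
Qed.

Lemma fsub_fexp_ht f : U (hw 0 * f) = ht * U f.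
Proof. by rewrite -fexp_ht fsub_fexpM. Qed.

Lemma fsub_hw i (c : fps int) : (i <= 5)%N ->
  U (q ^+ (5 - i) * E ^+ i) = c * q * E5 ^+ i -> U (hw i) = c * ht.
Proof.
move=> i5 H; have -> : hw i = fexp (E5 ^+ (6 - i) * G ^+ 6) * (q ^+ (5 - i) * E ^+ i).
  by rewrite /hw rmorphM !rmorphXn /=; ring.
rewrite fsub_fexpM // H /ht.
have -> : E5 ^+ 6 = E5 ^+ (6 - i) * E5 ^+ i by rewrite -exprD subnK // ltnW.
by move: (E5 ^+ (6 - i)) (E5 ^+ i) => *; ring.
Qed.

Lemma fsub0_sum k0 k1 k2 k3 k4 (f0 f1 f2 f3 f4 : fps int) :
  U (q ^+ (5 * k0 + 0) * fexp f0 + q ^+ (5 * k1 + 1) * fexp f1 + q ^+ (5 * k2 + 2) * fexp f2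
          + q ^+ (5 * k3 + 3) * fexp f3 + q ^+ (5 * k4 + 4) * fexp f4) = q ^+ k0 * f0.
Proof. by rewrite !raddfD /= !fsub0_qvX_fexp //= !addr0. Qed.

Local Ltac push := rewrite !(rmorphD, rmorphN, rmorphM, rmorphXn, rmorph_nat, rmorph1) /= ?fexp_qv.

Let a : fps int := dis0 int.
Let c : fps int := dis2 int.
Let E_abc : E = fexp a - q * fexp E5 - q ^+ 2 * fexp c.
Proof. exact: euler_dissect. Qed.
Let ac : a * c = E5 ^+ 2. Proof. exact: dis02. Qed.

(** For each i from 1 to 4, the power E^i is expanded by the dissection and sorted by exponents
    modulo 5. From i = 2 on, A C = B^2 reduces the surviving block to an integer multiple of B^i. *)
Lemma fsub_hw1 : U (hw 1) = - ht.
Proof.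
rewrite -mulN1r; apply: fsub_hw => //; rewrite {1}E_abc.
move: (E5) (a) (c) => b a' c'.
transitivity (U (q ^+ (5 * 1 + 0) * fexp (- b) + q ^+ (5 * 1 + 1) * fexp (- c')
  + q ^+ (5 * 1 + 2) * fexp 0 + q ^+ (5 * 1 + 3) * fexp 0 + q ^+ (5 * 0 + 4) * fexp a')).
  by congr (U _); rewrite rmorph0; push; ring.
by rewrite fsub0_sum; ring.
Qed.

Lemma fsub_hw2 : U (hw 2) = - ht.
Proof.
rewrite -mulN1r; apply: fsub_hw => //; rewrite {1}E_abc.
move: (E5) (a) (c) ac => b a' c' ac'.
transitivity (U (q ^+ (5 * 1 + 0) * fexp (b ^+ 2 - 2 * (a' * c')) + q ^+ (5 * 1 + 1) * fexp (2 * b * c')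
  + q ^+ (5 * 1 + 2) * fexp (c' ^+ 2) + q ^+ (5 * 0 + 3) * fexp (a' ^+ 2)
  + q ^+ (5 * 0 + 4) * fexp (- (2 * a' * b)))).
  by congr (U _); push; ring.
by rewrite fsub0_sum ?ac'; ring.
Qed.

Lemma fsub_hw3 : U (hw 3) = 5 * ht.
Proof.
apply: fsub_hw => //; rewrite {1}E_abc.
move: (E5) (a) (c) ac => b a' c' ac'.
transitivity (U (q ^+ (5 * 1 + 0) * fexp (- b ^+ 3 + 6 * b * (a' * c'))
  + q ^+ (5 * 1 + 1) * fexp (3 * a' * c' ^+ 2 - 3 * b ^+ 2 * c')
  + q ^+ (5 * 0 + 2) * fexp (a' ^+ 3 - 3 * q * b * c' ^+ 2)
  + q ^+ (5 * 0 + 3) * fexp (- (3 * a' ^+ 2 * b) - q * c' ^+ 3)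
  + q ^+ (5 * 0 + 4) * fexp (3 * a' * b ^+ 2 - 3 * a' ^+ 2 * c'))).
  by congr (U _); push; ring.
by rewrite fsub0_sum ?ac'; ring.
Qed.

Lemma fsub_hw4 : U (hw 4) = - 5 * ht.
Proof.
apply: fsub_hw => //; rewrite {1}E_abc.
move: (E5) (a) (c) ac => b a' c' ac'.
transitivity (U (q ^+ (5 * 1 + 0) * fexp (b ^+ 4 - 12 * (a' * c') * b ^+ 2 + 6 * (a' * c') ^+ 2)
  + q ^+ (5 * 0 + 1) * fexp (a' ^+ 4 + q * (4 * b ^+ 3 * c' - 12 * a' * b * c' ^+ 2))
  + q ^+ (5 * 0 + 2) * fexp (- (4 * a' ^+ 3 * b) + q * (6 * b ^+ 2 * c' ^+ 2 - 4 * a' * c' ^+ 3))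
  + q ^+ (5 * 0 + 3) * fexp (6 * a' ^+ 2 * b ^+ 2 - 4 * a' ^+ 3 * c' + q * (4 * b * c' ^+ 3))
  + q ^+ (5 * 0 + 4) * fexp (- (4 * a' * b ^+ 3) + 12 * a' ^+ 2 * b * c' + q * c' ^+ 4))).
  by congr (U _); push; ring.
by rewrite fsub0_sum ?ac'; ring.
Qed.
End Iteration.

(** * 5-adic bounds *)

(* The polynomials in [ht] without constant term whose coefficient at [ht ^+ j]
   is divisible by 5 ^ floor((5 j - e) / 2); the truncated subtraction makes the
   condition void for 5 j <= e. *)
Inductive span5 (e : nat) : fps int -> Prop :=
| span5_0 : span5 e 0
| span5D f g : span5 e f -> span5 e g -> span5 e (f + g)
| span5_gen (c : fps int) m j : (0 < j)%N -> c = m%:~R ->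
    span5 e (c * 5 ^+ (5 * j - e)./2 * ht ^+ j).

Lemma span5_int e (m : int) f : span5 e f -> span5 e (m%:~R * f).
Proof.
elim=> [|f1 f2 _ H1 _ H2|c m' j j0 ->]; first by rewrite mulr0; apply: span5_0.
  by rewrite mulrDr; apply: span5D.
by rewrite !mulrA -rmorphM; apply: (span5_gen _ j0 (erefl _)).
Qed.

Lemma span5_nat e n f : span5 e f -> span5 e (n%:R * f).
Proof. by move=> H; have := span5_int n H; rewrite -pmulrn. Qed.

(** The exponent of 5 is half of 5 j - e, so k factors of 5 allow e to drop by 2 k. *)
Lemma span5_exp k e e' f : (e <= e' + k.*2)%N -> span5 e f -> span5 e' (5 ^+ k * f).
Proof.
move=> ee; elim=> [|f1 f2 _ H1 _ H2|c m j j0 cm]; first by rewrite mulr0; apply: span5_0.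
  by rewrite mulrDr; apply: span5D.
set A := (5 * j - e)./2; set A' := (5 * j - e')./2.
have H : 5 ^+ k * 5 ^+ A = 5 ^+ (k + A - A') * 5 ^+ A' :> fps int.
  by rewrite -!exprD; congr (_ ^+ _); rewrite /A /A'; lia.
have -> : 5 ^+ k * (c * 5 ^+ A * ht ^+ j) = 5 ^+ (k + A - A') * c * 5 ^+ A' * ht ^+ j.
  transitivity (c * (5 ^+ k * 5 ^+ A) * ht ^+ j); last rewrite H.
    by move: (5 ^+ k) (5 ^+ A) (ht ^+ j) => *; ring.
  by move: (5 ^+ (k + A - A')) (5 ^+ A') (ht ^+ j) => *; ring.
apply: (@span5_gen _ _ (5 ^+ (k + A - A') * m)) => //.
by rewrite rmorphM rmorphXn /= -cm.
Qed.

Lemma span5_le e e' f : (e <= e')%N -> span5 e f -> span5 e' f.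
Proof. by move=> ee /(@span5_exp 0 e e'); rewrite mul1r addn0; apply. Qed.

Lemma span5_mul_ht e f : span5 e f -> span5 (e + 5) (ht * f).
Proof.
elim=> [|f1 f2 _ H1 _ H2|c m j j0 cm]; first by rewrite mulr0; apply: span5_0.
  by rewrite mulrDr; apply: span5D.
have -> : (5 * j - e = 5 * j.+1 - (e + 5))%N by lia.
by rewrite mulrCA -exprS; apply: (@span5_gen _ _ m).
Qed.

Lemma span5_ht e : (3 < e)%N -> span5 e ht.
Proof.
move=> e3; have := @span5_gen e 1 1 1 isT (erefl _).
by rewrite mul1r (_ : (5 * 1 - e)./2 = 0)%N ?mul1r //; lia.
Qed.

(** As j is positive and e is at most 3, the number 5 j - e is at least 2, so every coefficient can
    give up a 5. *)
Lemma span5_factor e f : (e <= 3)%N -> span5 e f -> exists2 g, f = 5 * g & span5 (e + 2) g.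
Proof.
move=> e3; elim=> [|f1 f2 _ [g1 -> h1] _ [g2 -> h2]|c m j j0 cm].
- by exists 0; rewrite ?mulr0 //; apply: span5_0.
- by exists (g1 + g2); rewrite ?mulrDr //; apply: span5D.
exists (c * 5 ^+ (5 * j - (e + 2))./2 * ht ^+ j); last exact: (@span5_gen _ _ m).
have -> : (5 * j - e)./2 = (5 * j - (e + 2))./2.+1 by lia.
by rewrite exprS; move: (5 ^+ _) (ht ^+ j) => *; ring.
Qed.

(** * The recurrence for U(x^i) and its 5-adic weights *)

Lemma fsub_nat r n (f : fps int) : fsub r (n%:R * f) = n%:R * fsub r f.
Proof. by rewrite !mulr_natl raddfMn. Qed.

Lemma fsub_int r (m : int) (f : fps int) : fsub r (m%:~R * f) = m%:~R * fsub r f.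
Proof. by rewrite !mulrzl raddfMz. Qed.

Lemma fsub_hw_hx i k : (i <= 4)%N -> (k <= 4)%N ->
  fsub 0 (hw i * hx ^+ k) = if (k < i)%N then fsub 0 (hw (i - k)) else ht * fsub 0 (hx ^+ (k - i)).
Proof.
have H n m : (n + m <= 4)%N -> hw (n + m) * hx ^+ n = hw m.
  by elim: n => [|n IH] nm; rewrite ?mulr1 // exprS mulrA addSn hw_hx ?IH //; lia.
move=> i4 k4; case: ltnP => ki; first by rewrite -{1}(subnKC (ltnW ki)) H //; lia.
by rewrite -{1}(subnKC ki) exprD mulrA -{1}[i]addn0 H ?addn0 // fsub_fexp_ht.
Qed.

Lemma mul_hY_expand (f : fps int) : f * hY =
  f * hx ^+ 0 + 5 * (f * hx ^+ 1) + 15 * (f * hx ^+ 2) + 25 * (f * hx ^+ 3) + 25 * (f * hx ^+ 4).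
Proof. by rewrite /hY; ring. Qed.

Lemma fsub_hx_small i : (i <= 4)%N -> let s k := fsub 0 (hw i * hx ^+ k) in
  fsub 0 (hx ^+ (5 - i)) = s 0%N + 5 * s 1%N + 15 * s 2%N + 25 * s 3%N + 25 * s 4%N.
Proof.
move=> i4 s; rewrite -hw_hY; last by lia.
by rewrite mul_hY_expand !raddfD /= !fsub_nat.
Qed.

Lemma fsub_hxD5 i (u := fun k => fsub 0 (hx ^+ (i + k))) :
  u 5%N = ht * (u 0%N + 5 * u 1%N + 15 * u 2%N + 25 * u 3%N + 25 * u 4%N).
Proof.
have -> : u 5%N = fsub 0 (hw 0 * (hx ^+ i * hY)).
  by rewrite /u mulrCA hw_hY // -exprD.
rewrite fsub_fexp_ht mul_hY_expand !raddfD /= !fsub_nat.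
by rewrite /u !exprD.
Qed.

Lemma span5_5 e f : span5 (e + 2) f -> span5 e (5 * f).
Proof. by move=> H; have := span5_exp (k := 1) (e' := e) _ H; rewrite expr1; apply; lia. Qed.

Lemma span5_15 e f : span5 (e + 2) f -> span5 e (15 * f).
Proof.
by move=> H; have -> : 15 * f = 3%:R * (5 * f) by [ring]; apply: span5_nat; apply: span5_5.
Qed.

Lemma span5_25 e f : span5 (e + 4) f -> span5 e (25 * f).
Proof.
move=> H; have -> : 25 * f = 5 * (5 * f) by ring.
by do 2!apply: span5_5; rewrite -addnA.
Qed.

Lemma fsub_hx0 : fsub 0 (hx ^+ 0) = 1.
Proof. by rewrite expr0 -{1}(rmorph1 (@fexp _)) fsub_fexp. Qed.

(** In the recurrence, t adds 5 to e, while the coefficients 1, 5, 15, 25, 25 of Y lower e by 0, 2,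
    2, 4, 4, which covers the growth of the bound by 0 to 4 along the five terms. *)
Lemma span5_fsub_hx i : (0 < i)%N -> span5 i.+1 (fsub 0 (hx ^+ i)).
Proof.
have h0 e : (3 < e)%N -> span5 e ht by apply: span5_ht.
have hu e f : span5 e f -> span5 (e + 5) (ht * f) by apply: span5_mul_ht.
have h1 : span5 2 (fsub 0 (hx ^+ 1)).
  have -> : fsub 0 (hx ^+ 1) = 5 * ht.
    rewrite (@fsub_hx_small 4) // !fsub_hw_hx //= fsub_hx0.
    by rewrite fsub_hw1 fsub_hw2 fsub_hw3 fsub_hw4; ring.
  by apply: span5_5; apply: h0.
have h2 : span5 3 (fsub 0 (hx ^+ 2)).
  have -> : fsub 0 (hx ^+ 2) = 5 * (2%:R * ht) + 25 * (ht * fsub 0 (hx ^+ 1)).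
    rewrite (@fsub_hx_small 3) // !fsub_hw_hx //= fsub_hx0.
    by rewrite fsub_hw1 fsub_hw2 fsub_hw3; ring.
  apply: span5D; first by apply: span5_5; apply: span5_nat; apply: h0.
  by apply: span5_25; apply: (span5_le _ (hu _ _ h1)).
have h3 : span5 4 (fsub 0 (hx ^+ 3)).
  have -> : fsub 0 (hx ^+ 3) = 9%:R * ht + 25 * (ht * fsub 0 (hx ^+ 1)) + 25 * (ht * fsub 0 (hx ^+ 2)).
    rewrite (@fsub_hx_small 2) // !fsub_hw_hx //= fsub_hx0.
    by rewrite fsub_hw1 fsub_hw2; ring.
  apply: span5D; last by apply: span5_25; apply: (span5_le _ (hu _ _ h2)).
  apply: span5D; last by apply: span5_25; apply: (span5_le _ (hu _ _ h1)).
  by apply: span5_nat; apply: h0.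
have h4 : span5 5 (fsub 0 (hx ^+ 4)).
  have -> : fsub 0 (hx ^+ 4) = 4%:R * ht + 15 * (ht * fsub 0 (hx ^+ 1))
       + 25 * (ht * fsub 0 (hx ^+ 2)) + 25 * (ht * fsub 0 (hx ^+ 3)).
    rewrite (@fsub_hx_small 1) // !fsub_hw_hx //= fsub_hx0.
    by rewrite fsub_hw1; ring.
  apply: span5D; last by apply: span5_25; apply: (span5_le _ (hu _ _ h3)).
  apply: span5D; last by apply: span5_25; apply: (span5_le _ (hu _ _ h2)).
  apply: span5D; last by apply: span5_15; apply: (span5_le _ (hu _ _ h1)).
  by apply: span5_nat; apply: h0.
(* The recurrence for x^5 involves U(1) = 1, which has a constant term and lies in no [span5], so
   this case precedes the induction. *)
have h5 : span5 6 (fsub 0 (hx ^+ 5)).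
  rewrite (fsub_hxD5 0) fsub_hx0 !mulrDr mulr1 ![ht * (_ * _)]mulrCA.
  apply: span5D; last by apply: span5_25; apply: (span5_le _ (hu _ _ h4)).
  apply: span5D; last by apply: span5_25; apply: (span5_le _ (hu _ _ h3)).
  apply: span5D; last by apply: span5_15; apply: (span5_le _ (hu _ _ h2)).
  apply: span5D; last by apply: span5_5; apply: (span5_le _ (hu _ _ h1)).
  exact: h0.
have P n i0 : (0 < i0 <= n)%N -> span5 i0.+1 (fsub 0 (hx ^+ i0)).
  elim: n i0 => [|n IH] [|[|[|[|[|[|k]]]]]] // kn.
  have IHk l : (l < 5)%N -> span5 (k + l).+2 (fsub 0 (hx ^+ (k.+1 + l))).
    by move=> l5; rewrite -addSn; apply: IH; lia.
  rewrite (_ : k.+4.+2 = k.+1 + 5)%N; last by lia.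
  rewrite (fsub_hxD5 k.+1) -[(k.+1 + 5).+1]addSn.
  apply: hu; rewrite !addn0.
  do 2!(apply: span5D; last by apply: span5_25; apply: span5_le (IHk _ _); lia).
  apply: span5D; last by apply: span5_15; apply: span5_le (IHk _ _); lia.
  apply: span5D; last by apply: span5_5; apply: span5_le (IHk _ _); lia.
  by have := IHk 0%N isT; rewrite !addn0.
by move=> i0; apply: (P i); rewrite i0 leqnn.
Qed.

(** Multiplying by Y does not worsen the bound: each extra power of x comes with enough factors of
    5. *)
Lemma span5_fsub_hx_hY j i : (0 < i)%N -> span5 i.+1 (fsub 0 (hx ^+ i * hY ^+ j)).
Proof.
elim: j i => [|j IH] i i0; first by rewrite mulr1; apply: span5_fsub_hx.
rewrite exprS mulrA mulrAC mul_hY_expand !raddfD /= !fsub_nat.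
have IHl l : span5 (i + l).+1 (fsub 0 (hx ^+ i * hY ^+ j * hx ^+ l)).
  by rewrite mulrAC -exprD; apply: IH; lia.
do 2!(apply: span5D; last by apply: span5_25; apply: span5_le (IHl _); lia).
apply: span5D; last by apply: span5_15; apply: span5_le (IHl _); lia.
apply: span5D; last by apply: span5_5; apply: span5_le (IHl _); lia.
by apply: span5_le (IHl _); lia.
Qed.

(** * The two half-steps of the iteration and the congruences *)

Lemma span5_odd_to_even f : span5 5 f -> exists2 g, fsub 0 f = 5 * g & span5 4 g.
Proof.
elim=> [|f1 f2 _ [g1 h1 H1] _ [g2 h2 H2]|c m j j0 ->].
- by exists 0; rewrite ?raddf0 ?mulr0 //; apply: span5_0.
- by exists (g1 + g2); rewrite ?raddfD /= ?h1 ?h2 ?mulrDr //; apply: span5D.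
have H : span5 j.+1 (fsub 0 (ht ^+ j)) by rewrite ht_hx exprMn; apply: span5_fsub_hx_hY.
rewrite -mulrA fsub_int -natrX fsub_nat natrX.
(* For j = 1 the coefficient offers no factor 5, and it is taken from U(t) itself; for j >= 2 it
   comes from the power of 5 in the coefficient. *)
case: j j0 H => [|[|j]] // _ H.
  have [g -> gH] := span5_factor (isT : 2 <= 3)%N H.
  by exists (m%:~R * g); [rewrite (_ : (5 * 1 - 5)./2 = 0)%N //; ring | apply: span5_int].
have -> : (5 * j.+2 - 5)./2 = (5 * j.+2 - 7)./2.+1 by lia.
exists (m%:~R * (5 ^+ (5 * j.+2 - 7)./2 * fsub 0 (ht ^+ j.+2))).
  by rewrite exprS; move: (5 ^+ _) (fsub _ _) => *; ring.
by apply: span5_int; apply: span5_exp H; lia.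
Qed.

Lemma span5_even_to_odd f : span5 4 f -> span5 5 (fsub 0 (hx ^+ 2 * f)).
Proof.
elim=> [|f1 f2 _ H1 _ H2|c m j j0 ->].
- by rewrite mulr0 raddf0; apply: span5_0.
- by rewrite mulrDr raddfD; apply: span5D.
have H : span5 (j + 3) (fsub 0 (hx ^+ 2 * ht ^+ j)).
  by rewrite addnC ht_hx [(hx * hY) ^+ j]exprMn mulrA -exprD; apply: span5_fsub_hx_hY.
rewrite -mulrA mulrCA fsub_int mulrCA -natrX fsub_nat natrX; apply: span5_int.
by apply: span5_exp H; case: j j0 => [|[|j]] // _; lia.
Qed.

(* For n > 0 the coefficients at n of [p_even a] and [p_odd a] are the values of
   p_{-2} at 25^a n - (25^a - 1) / 12 and 5 * 25^a n - (25^(a + 1) - 1) / 12. *)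
Fixpoint p_even a : fps int :=
  if a is a'.+1 then fsub 0 (fsub 0 (qv ^+ 2 * p_even a')) else eulerV ^+ 2.
Definition p_odd a := fsub 0 (qv ^+ 2 * p_even a).

Lemma p_even_span a f : p_odd a = 5 ^+ a.+1 * (fexp eulerV ^+ 2 * f) -> span5 5 f ->
  exists2 g, p_even a.+1 = 5 ^+ a.+2 * (eulerV ^+ 2 * g) & span5 4 g.
Proof.
move=> fE /span5_odd_to_even[g gE gH]; exists g => //.
rewrite /= -/(p_odd a) fE -natrX fsub_nat natrX (_ : fexp eulerV ^+ 2 = fexp (eulerV ^+ 2)); last by rewrite rmorphXn.
rewrite fsub_fexpM // gE [5 ^+ a.+2]exprS.
by move: (5 ^+ a.+1) => *; ring.
Qed.

(** Since q^2 G^2 = E(q^25)^-2 x^2, multiplying by q^2 and sectioning sends G^2 g to E(q^5)^-2 U(x^2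
    g). The first factor 5 comes from U(x^2), the later ones from [p_even_span]. *)
Lemma p_odd_span a : exists2 f, p_odd a = 5 ^+ a.+1 * (fexp eulerV ^+ 2 * f) & span5 5 f.
Proof.
have hx2 : qv ^+ 2 * eulerV ^+ 2 = fexp (fexp eulerV ^+ 2) * hx ^+ 2 :> fps int.
  rewrite rmorphXn /= -exprMn /hx -exprMn -[in LHS](mulr1 (qv * _)) -euler25K.
  by congr (_ ^+ 2); ring.
elim: a => [|a [f fE fH]].
  have [g gE gH] := span5_factor (isT : 3 <= 3)%N (@span5_fsub_hx 2 isT).
  by exists g => //; rewrite /p_odd /= hx2 fsub_fexpM // gE; ring.
have [g gE gH] := p_even_span fE fH.
exists (fsub 0 (hx ^+ 2 * g)); last exact: span5_even_to_odd.
rewrite /p_odd gE mulrCA -natrX fsub_nat natrX; congr (_ * _).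
by rewrite mulrA hx2 -mulrA fsub_fexpM.
Qed.

(** Each round replaces the index n by 25 n - 2. The hypothesis on k is the resulting closed form,
    cleared of division and subtraction. *)
Lemma coefs_p_even a n k : (0 < n)%N -> (12 * k + 25 ^ a = 12 * (25 ^ a * n) + 1)%N ->
  p_even a n = (p_minus2 k)%:R.
Proof.
elim: a n k => [|a IH] n k n0 H.
  by rewrite p_minus2_coef; congr (coefs _ _); lia.
rewrite -[LHS]/((qv ^+ 2 * p_even a) (5 * (5 * n + 0) + 0)%N) coefs_qvXM ifF; last by lia.
apply: IH; first by lia.
move: H; rewrite expnS; have : (0 < 25 ^ a)%N by rewrite expn_gt0.
by case: n n0 => // n _; rewrite (_ : 5 * (5 * n.+1 + 0) + 0 - 2 = 25 * n + 23)%N; nia.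
Qed.

Lemma coefs_p_odd a n k : (0 < n)%N -> (12 * k + 25 ^ a = 12 * (25 ^ a * (5 * n - 2)) + 1)%N ->
  p_odd a n = (p_minus2 k)%:R.
Proof.
move=> n0 H; rewrite -[LHS]/((qv ^+ 2 * p_even a) (5 * n + 0)%N) coefs_qvXM addn0 ifF; last by lia.
by apply: coefs_p_even => //; lia.
Qed.

Lemma coefs_mod (p m : nat) (f g : fps int) n :
  f = 5 ^+ m * g -> f n = p%:R -> (p = 0 %[mod 5 ^ m])%N.
Proof.
move=> ->; rewrite -natrX mulr_natl coefsMn => /(congr1 absz).
rewrite -[g n *+ _]mulr_natr abszM !natz /= => <-.
by rewrite modnMl mod0n.
Qed.

Local Close Scope ring_scope.

Theorem theorem1p2 (n alpha : nat) (halpha : 1 <= alpha) :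
  p_minus2 (5 ^ (2 * alpha - 1) * n + (7 * 5 ^ (2 * alpha - 1) + 1) %/ 12)
    = 0 %[mod 5 ^ alpha] /\
  p_minus2 (5 ^ (2 * alpha) * n + (11 * 5 ^ (2 * alpha) + 1) %/ 12)
    = 0 %[mod 5 ^ (alpha + 1)].
Proof.
have D1 := dvdn_offset_odd halpha; have D2 := dvdn_offset_even alpha.
case: alpha halpha D1 D2 => // a _.
have -> : (5 ^ (2 * a.+1 - 1) = 5 * 25 ^ a)%N.
  by rewrite (_ : 2 * a.+1 - 1 = (2 * a).+1)%N ?expnS ?expnM //; lia.
have -> : (5 ^ (2 * a.+1) = 25 * 25 ^ a)%N by rewrite expnM expnS.
move=> /dvdnP[k1 e1] /dvdnP[k2 e2].
rewrite e1 e2 !mulnK // addn1.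
have [f fE fH] := p_odd_span a; have [g gE _] := p_even_span fE fH; split.
  (* The index n + 1 turns the negative offset into the stated one: 5 * 25^a - (25^(a+1) - 1) / 12 =
     (7 * 5 * 25^a + 1) / 12. In the even case, 25^(a+1) - (25^(a+1) - 1) / 12 = (11 * 25^(a+1) + 1)
     / 12. *)
  apply: (@coefs_mod _ _ _ _ n.+1 fE); apply: coefs_p_odd => //.
  rewrite (_ : 5 * n.+1 - 2 = 5 * n + 3)%N; nia.
apply: (@coefs_mod _ _ _ _ n.+1 gE); apply: coefs_p_even => //.
by rewrite expnS; move: (25 ^ a)%N e2 => x e2; lia.
Qed.
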